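(* Let $t\ge 2$ be an integer and let $A$ be a column-$t$-partite zero-one matrix. Then $$\operatorname{ex}(n,A)<n^{2-\frac{1}{t}+\frac{1}{2t^{2}}+o(1)},$$ that is, for every $\varepsilon>0$ there exists $n_0$ such that $\operatorname{ex}(n,A)<n^{2-\frac1t+\frac{1}{2t^2}+\varepsilon}$ for all $n\ge n_0$.
   Context: A zero-one matrix $M$ contains a zero-one matrix $A$ if one can delete some rows and columns of $M$ and turn some $1$-entries into $0$-entries so that the resulting matrix is $A$. The weight $w(M)$ is the number of $1$-entries of $M$. The extremal number $\operatorname{ex}(n,A)$ is the maximum weight of an $n\times n$ zero-one matrix that does not contain $A$. A matrix $A$ is column-$t$-partite if its columns can be cut into $t$ consecutive intervals, giving $t$ submatrices, such that every row of each of these submatrices contains at most one $1$-entry. *)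

(* Defs.v *)
From mathcomp Require Import all_boot all_algebra.
Set Implicit Arguments. Unset Strict Implicit. Unset Printing Implicit Defensive.

Definition weight (m n : nat) (M : 'M[bool]_(m, n)) : nat :=
  #|[set ij : 'I_m * 'I_n | M ij.1 ij.2]|.

(* M contains A: keep the rows f(0)<...<f(k-1) and columns g(0)<...<g(l-1)
   of M (delete the others), then turn some 1s into 0s to obtain A; i.e.
   every 1-entry of A sits on a 1-entry of M at the selected positions. *)
Definition contains (m n k l : nat) (M : 'M[bool]_(m, n)) (A : 'M[bool]_(k, l)) : bool :=
  [exists f : {ffun 'I_k -> 'I_m}, exists g : {ffun 'I_l -> 'I_n},
     [&& [forall i1 : 'I_k, forall i2 : 'I_k, (i1 < i2) ==> (f i1 < f i2)],
         [forall j1 : 'I_l, forall j2 : 'I_l, (j1 < j2) ==> (g j1 < g j2)] &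
         [forall i : 'I_k, forall j : 'I_l, A i j ==> M (f i) (g j)]]].

Definition ex (n k l : nat) (A : 'M[bool]_(k, l)) : nat :=
  \max_(M : 'M[bool]_(n, n) | ~~ contains M A) weight M.

(* column-t-partite: the columns are cut into t consecutive intervals,
   encoded by a nondecreasing map p assigning to each column its interval,
   such that in each row each interval contains at most one 1-entry. *)
Definition col_partite (t k l : nat) (A : 'M[bool]_(k, l)) : Prop :=
  exists p : 'I_l -> 'I_t,
    (forall j1 j2 : 'I_l, j1 <= j2 -> p j1 <= p j2) /\
    (forall (i : 'I_k) (s : 'I_t), #|[set j : 'I_l | A i j && (p j == s)]| <= 1).

(* Main.v *)
Require Import Defs.
From mathcomp Require Import all_boot all_order all_algebra.
From mathcomp Require Import zify ring lra.
Set Implicit Arguments. Unset Strict Implicit. Unset Printing Implicit Defensive.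
Import Order.TTheory GRing.Theory Num.Theory.

(** Give a row [r] of degree [d] at least half the average the weight [1/d], and
    other rows weight [0].  For a set [R] of consecutive rows let the energy of [R] be
    the sum, over the [t]-sets [c] of columns, of the [t]-th power of the total weight
    of the rows of [R] that have a 1 in all columns of [c].  A single row has energy at
    most 1, while by convexity the whole matrix has energy at least about
    [n^t p^(t(t-1))], where [p] is the density.

    Cut [R] into [K] intervals.  The [t]-sets whose common rows meet fewer than [k]
    of the intervals contribute at most [k^t] times the total energy of the parts.
    If the other [t]-sets carry a constant fraction of the energy, dependent random
    choice ([t] random rows of [R]) yields a large set [S] of columns with a positive
    proportion of its [t]-sets of this second kind; pigeonhole and Erdos's box theorem
    then give [B_1 < ... < B_t] in [S] and [k] intervals such that every transversal
    of the [B_i] has a common row in each of the [k] intervals, whence a copy of [A].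
    So when [A] is avoided, the energy grows by a factor of at most about [k^t K] when
    the interval grows by a factor [K].  For [K] large this bounds the
    energy of the whole matrix by [n^(1+o(1))], which forces [p <= n^(-1/t+o(1))]. *)

(** * Boxes in dense sets of tuples *)

Lemma card_cons_tuple (T : finType) t (P : pred (t.+1.-tuple T)) :
  #|P| = \sum_(x : T) #|[pred c : t.-tuple T | P [tuple of x :: c]]|.
Proof.
rewrite -sum1_card.
rewrite (reindex (fun p : T * t.-tuple T => [tuple of p.1 :: p.2])) /=; last first.
  exists (fun c => (thead c, [tuple of behead c])) => [[x c] _|c _] /=.
    by congr pair; apply: val_inj.
  by rewrite [RHS]tuple_eta; apply: val_inj.
under [RHS]eq_bigr do rewrite -sum1_card.
by rewrite pair_big_dep.
Qed.

Lemma card_tuples_in (T : finType) t (S : {set T}) :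
  #|[pred c : t.-tuple T | all (mem S) c]| = #|S| ^ t.
Proof.
elim: t => [|t IH].
  transitivity #|{: 0.-tuple T}|; last by rewrite card_tuple.
  by apply: eq_card => c; rewrite !inE tuple0.
rewrite card_cons_tuple (bigID (mem S)) /= [X in _ + X]big1 ?addn0.
  rewrite (eq_bigr (fun _ => #|S| ^ t)) ?sum_nat_const -?expnS // => x xS.
  by rewrite -IH; apply: eq_card => c; rewrite !inE /= xS.
by move=> x /negPf xS; apply: eq_card0 => c; rewrite !inE /= xS.
Qed.

Lemma exists_subset_card (T : finType) (A : {set T}) h :
  h <= #|A| -> exists2 B : {set T}, B \subset A & #|B| = h.
Proof.
move=> hA; have : 0 < #|[set B : {set T} | B \subset A & #|B| == h]|.
  by rewrite cards_draws bin_gt0.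
by case/card_gt0P => B; rewrite inE => /andP[BA /eqP]; exists B.
Qed.

Lemma sum_pigeonhole (I : finType) (A : {set I}) (F : I -> nat) N :
  0 < N -> N <= \sum_(i in A) F i -> exists2 i, i \in A & N <= #|A| * F i.
Proof.
move=> N0 NF; have A0 : 0 < #|A|.
  by rewrite card_gt0; apply: contraTneq NF => ->; rewrite big_set0 -ltnNge.
apply/exists_inP; apply: contraLR NF => /exists_inPn small.
rewrite -ltnNge -(@ltn_pmul2l #|A|) // big_distrr /=.
apply: (@leq_ltn_trans (\sum_(i in A) N.-1)); last first.
  by rewrite sum_nat_const ltn_pmul2l // ltn_predL.
by apply: leq_sum => i /small; rewrite -ltnNge => lt; rewrite -ltnS prednK.
Qed.

(** Induction on [t]. Many tails extend by at least [l] members of a bounded set [Y] of first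
    coordinates of large degree; by pigeonhole a positive proportion of them extend by the same
    subset [X] of [Y]. [X] is the first side, and induction on these tails gives the others. *)
Lemma erdos_box t l C : 0 < l -> exists L, forall (T : finType) (S : {set T})
    (G : {set t.-tuple T}),
  L <= #|S| -> (forall c, c \in G -> all (mem S) c) -> #|S| ^ t <= C * #|G| ->
  exists2 B : nat -> {set T}, (forall i, i < t -> l <= #|B i|) &
    forall c : t.-tuple T, (forall i : 'I_t, tnth c i \in B i) -> c \in G.
Proof.
move=> l0; elim: t C => [|t IH] C.
  exists 0 => T S G _ _; rewrite expn0 muln_gt0 => /andP[_ /card_gt0P[c0 c0G]].
  by exists (fun=> set0) => // c _; rewrite tuple0 -(tuple0 c0).
(* The members of [Y] will have degree at least [N ^ t / (2 * C)], so with [h] of them a tail is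
   completed on average by at least [2 * l]. *)
pose h := 4 * C * l.
have [L HL] := IH (h * 2 ^ h).
(* The second bound provides [h] coordinates of large degree, as there are at least
   [N / (2 * C)]. *)
exists (maxn L (2 * C * h).+1) => T S G; rewrite geq_max => /andP[LS hS] GS dG.
have N0 : 0 < #|S| by lia.
set N := #|S| in N0 LS hS dG *.
have C0 : 0 < C by case: C dG {IH h HL hS} => //; rewrite mul0n leqNgt expn_gt0 N0.
pose deg x := #|[pred c : t.-tuple T | [tuple of x :: c] \in G]|.
have degS x : x \notin S -> deg x = 0.
  move=> xS; apply: eq_card0 => c; rewrite !inE; apply/negP => /GS /=.
  by rewrite (negPf xS).
have degN x : deg x <= N ^ t.
  rewrite -card_tuples_in; apply: subset_leq_card; apply/subsetP => c.
  by rewrite !inE => /GS /= /andP[].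
have sumdeg : \sum_(x in S) deg x = #|G|.
  rewrite (eq_card (B := [pred c | c \in G])) // card_cons_tuple.
  by rewrite [RHS](bigID (mem S)) /= [X in _ = _ + X]big1 ?addn0.
pose Hv := [set x in S | N ^ t <= 2 * C * deg x].
have HvS : Hv \subset S by apply/subsetP => x; rewrite inE => /andP[].
have hHv : h <= #|Hv|.
  have le1 : 2 * C * #|G| <= 2 * C * N ^ t * #|Hv| + N * N ^ t.
    rewrite -sumdeg (big_setID Hv) /= (setIidPr HvS) mulnDr; apply: leq_add.
      rewrite -[2 * C * N ^ t * _]mulnA leq_mul2l [N ^ t * _]mulnC -sum_nat_const.
      apply/orP; right.
      exact: leq_sum.
    rewrite big_distrr /= -sum_nat_const.
    apply: (@leq_trans (\sum_(i in S :\: Hv) N ^ t)); last first.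
      rewrite !sum_nat_const leq_mul2r; apply/orP; right.
      by apply: subset_leq_card; apply: subsetDl.
    by apply: leq_sum => x; rewrite !inE => /andP[]; case: (x \in S) => //=; lia.
  have Nt : 0 < N ^ t by rewrite expn_gt0 N0.
  have : N ^ t * N <= N ^ t * (2 * C * #|Hv|) by rewrite expnS in dG; nia.
  rewrite leq_pmul2l // => NH.
  rewrite -(@leq_pmul2l (2 * C)); lia.
have [Y YHv cY] := exists_subset_card hHv.
pose D (c : t.-tuple T) := [set x in Y | [tuple of x :: c] \in G].
pose St := [pred c : t.-tuple T | all (mem S) c].
have cSt : #|St| = N ^ t by rewrite card_tuples_in.
have sumD : \sum_(x in Y) deg x = \sum_(c in St) #|D c|.
  under eq_bigr do rewrite /deg -sum1_card.
  under [RHS]eq_bigr do rewrite -sum1_card.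
  rewrite (exchange_big_dep (mem St)) /=; last first.
    by move=> x c _ /GS /= /andP[].
  by apply: eq_bigr => c _; apply: eq_bigl => x; rewrite !inE.
have sumD2 : 2 * l * N ^ t <= \sum_(c in St) #|D c|.
  rewrite -sumD -(@leq_pmul2l (2 * C)) ?muln_gt0 ?C0 // big_distrr /=.
  have -> : 2 * C * (2 * l * N ^ t) = \sum_(x in Y) N ^ t.
    by rewrite sum_nat_const cY /h; lia.
  by apply: leq_sum => x /(subsetP YHv); rewrite inE => /andP[].
pose W := [set c in St | l <= #|D c|].
have WSt : l * N ^ t <= h * #|W|.
  suff : \sum_(c in St) #|D c| <= h * #|W| + l * N ^ t by lia.
  rewrite (bigID (fun c => l <= #|D c|)) /=; apply: leq_add.
    rewrite mulnC -sum_nat_const big_mkcond [X in _ <= X]big_mkcond /=.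
    apply: leq_sum => c _; rewrite !inE; case: ifP => // _.
    by rewrite -cY; apply: subset_leq_card; apply/subsetP => x; rewrite inE => /andP[].
  rewrite -cSt mulnC -sum_nat_const [X in _ <= X](bigID (fun c => l <= #|D c|)) /=.
  apply: leq_trans (leq_addl _ _); apply: leq_sum => c /andP[_]; lia.
have sumW : #|W| = \sum_(X in powerset Y) #|[set c in W | D c == X]|.
  rewrite -sum1_card (partition_big D (mem (powerset Y))) /=; last first.
    move=> c _; rewrite inE; apply/subsetP => x; rewrite inE => /andP[] //.
  by apply: eq_bigr => X _; rewrite -sum1_card; apply: eq_bigl => c; rewrite !inE.
have Nt : 0 < N ^ t by rewrite expn_gt0 N0.
have W0 : 0 < #|W|.
  by rewrite lt0n; apply: contraTneq WSt => ->; rewrite muln0 -ltnNge muln_gt0 l0.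
have [X XY] := sum_pigeonhole W0 (eq_leq sumW).
rewrite card_powerset cY => HX.
have X0 : 0 < #|[set c in W | D c == X]|.
  rewrite lt0n; apply/eqP => e; move: HX; rewrite e muln0 leqn0 => /eqP e2.
  by move: WSt; rewrite e2 muln0 leqn0 muln_eq0; lia.
set G' := [set c in W | D c == X] in X0 HX.
have G'S c : c \in G' -> all (mem S) c.
  by rewrite !inE => /andP[/andP[]].
have dG' : N ^ t <= h * 2 ^ h * #|G'|.
  apply: (@leq_trans (l * N ^ t)); first by rewrite leq_pmull.
  by apply: leq_trans WSt _; rewrite -mulnA leq_mul2l HX orbT.
have [B Bl BG] := HL T S G' LS G'S dG'.
exists (fun i => if i is i'.+1 then B i' else X) => [[_|i /Bl //]|c cB].
  by case/card_gt0P: X0 => c; rewrite !inE => /andP[/andP[_ lD] /eqP <-].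
have : [tuple of behead c] \in G'.
  apply: BG => i; have := cB (lift ord0 i).
  by rewrite {1}(tuple_eta c) tnthS.
rewrite !inE => /andP[_ /eqP DX].
have := cB ord0; rewrite /= -DX inE => /andP[_].
by congr (_ \in G); apply: val_inj; rewrite /= [in RHS](tuple_eta c).
Qed.

(** * Copies of the pattern from boxes *)

Lemma sorted_enum_ord n (X : {set 'I_n}) :
  sorted (fun x y : 'I_n => x < y) (enum X).
Proof.
rewrite {1}/enum_mem -enumT sorted_filter //; first by move=> x y z; apply: ltn_trans.
have := iota_ltn_sorted 0 n; by rewrite -val_enum_ord sorted_map.
Qed.

Lemma nth_enum_ltn n (x0 : 'I_n) (X : {set 'I_n}) i j :
  i < j -> j < #|X| -> nth x0 (enum X) i < nth x0 (enum X) j.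
Proof.
move=> ij jX; apply: (sorted_ltn_nth (leT := fun x y : 'I_n => x < y)) => //.
- by move=> x y z; apply: ltn_trans.
- exact: sorted_enum_ord.
- by rewrite inE -cardE (ltn_trans ij).
- by rewrite inE -cardE.
Qed.

(** Column [j] goes to the element of index [j] in the side [B (p j)]. The 1s of row [i] of [A] lie
    in distinct intervals, so their images extend to a transversal, whose common row in [I i]
    receives row [i]. *)
Lemma contains_of_boxes t m n k l (A : 'M[bool]_(k, l)) (M : 'M[bool]_(m, n))
    (I : 'I_k -> {set 'I_m}) (B : nat -> {set 'I_n}) :
  0 < t -> col_partite t A -> (forall s, s < t -> l < #|B s|) ->
  (forall i1 i2 : 'I_k, i1 < i2 ->
    forall r1 r2, r1 \in I i1 -> r2 \in I i2 -> r1 < r2) ->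
  (forall c : t.-tuple 'I_n, (forall s : 'I_t, tnth c s \in B s) ->
    sorted (fun x y : 'I_n => x < y) c /\
    forall i : 'I_k, exists2 r, r \in I i & forall x, x \in c -> M r x) ->
  contains M A.
Proof.
move=> t0 [p [pmono punique]] cB Imono HB.
have [x0 _] : exists x0, x0 \in B 0.
  by apply/set0Pn; rewrite -card_gt0; apply: leq_ltn_trans (cB 0 t0).
pose nB s j := nth x0 (enum (B s)) j.
have nBin s j : s < t -> j <= l -> nB s j \in B s.
  by move=> st jl; rewrite -mem_enum mem_nth // -cardE (leq_ltn_trans jl) // cB.
pose col (j : 'I_l) := nB (p j) j.
have colin j : col j \in B (p j) by apply: nBin; rewrite ?ltn_ord // ltnW.
(* The transversal for row [i], filled with [nB s 0] where the row has no 1 in interval [s]. *)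
pose ci (i : 'I_k) := [tuple
  (if [pick j | A i j && (p j == s)] is Some j then col j else nB s 0) | s < t].
have ciB i (s : 'I_t) : tnth (ci i) s \in B s.
  rewrite tnth_mktuple; case: pickP => [j /andP[_ /eqP <-]|_]; first exact: colin.
  exact: nBin.
have hrow (i : 'I_k) : exists r, (r \in I i) && [forall x in ci i, M r x].
  have [_ /(_ i)[r rI rM]] := HB _ (ciB i).
  by exists r; rewrite rI; apply/forall_inP.
apply/existsP; exists [ffun i => xchoose (hrow i)].
apply/existsP; exists [ffun j => col j]; apply/and3P; split.
- apply/forallP => i1; apply/forallP => i2; apply/implyP => lt12.
  rewrite !ffunE; apply: (Imono _ _ lt12).
    by case/andP: (xchooseP (hrow i1)).
  by case/andP: (xchooseP (hrow i2)).
- apply/forallP => j1; apply/forallP => j2; apply/implyP => lt12.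
  rewrite !ffunE /col.
  have [e|ne] := eqVneq (p j1) (p j2).
    by rewrite e; apply: nth_enum_ltn => //; apply: ltn_trans (cB _ _).
  have ltp : p j1 < p j2 by rewrite ltn_neqAle ne pmono // ltnW.
  (* Columns of different intervals are compared by putting both images on one transversal, which is
     sorted. *)
  pose c := [tuple if s == p j1 then col j1 else
    if s == p j2 then col j2 else nB s 0 | s < t].
  have cin (s : 'I_t) : tnth c s \in B s.
    rewrite tnth_mktuple; case: eqP => [->|_]; first exact: colin.
    by case: eqP => [->|_]; [exact: colin|exact: nBin].
  have [srt _] := HB c cin.
  have := sorted_ltn_nth (leT := fun x y : 'I_n => x < y) _ x0 srt.
  move=> /(_ _ (p j1) (p j2)); rewrite !inE size_tuple !ltn_ord.
  rewrite -!tnth_nth !tnth_mktuple !eqxx eq_sym (negPf ne); apply => //.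
  by move=> x y z; apply: ltn_trans.
apply/forallP => i; apply/forallP => j; apply/implyP => Aij; rewrite !ffunE.
case/andP: (xchooseP (hrow i)) => _ /forall_inP; apply.
apply/tnthP; exists (p j); rewrite tnth_mktuple; case: pickP => [j'|/(_ j)].
  move=> Aj'; congr col; apply: esym; apply/eqP; apply: contraT => ne.
  have := punique i (p j); rewrite leqNgt => /negP[].
  apply: (@leq_trans #|[set j'; j]|); first by rewrite cards2 ne.
  apply: subset_leq_card; apply/subsetP => j''.
  by rewrite !inE => /orP[] /eqP -> //; rewrite Aij eqxx.
by rewrite Aij eqxx.
Qed.

(** Each factor [s - i] of the falling factorial is at least [s / 2]. *)
Lemma expn_le_bin t s : 2 * t <= s -> s ^ t <= 2 ^ t * t`! * 'C(s, t).
Proof.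
move=> ts; rewrite -mulnA [t`! * _]mulnC bin_ffact ffact_prod.
have -> : 2 ^ t = \prod_(i < t) 2 by rewrite prod_nat_const card_ord.
have {1}-> : s ^ t = \prod_(i < t) s by rewrite prod_nat_const card_ord.
rewrite -big_split /=; apply: leq_prod => i _; have := ltn_ord i; lia.
Qed.

Lemma bin_le_expn s t : 'C(s, t) <= s ^ t.
Proof.
apply: (@leq_trans (s ^_ t)); first by rewrite -bin_ffact leq_pmulr ?fact_gt0.
rewrite ffact_prod (leq_trans (n := \prod_(i < t) s)) //.
  by apply: leq_prod => i _; apply: leq_subr.
by rewrite prod_nat_const card_ord.
Qed.

Section Blocks.
Variables (m n K : nat) (M : 'M[bool]_(m, n)) (R : {set 'I_m}) (blk : 'I_m -> 'I_K).

Definition common_rows (c : {set 'I_n}) : {set 'I_m} :=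
  [set r in R | [forall x in c, M r x]].

Definition blocks_of (c : {set 'I_n}) : {set 'I_K} := blk @: common_rows c.

Definition tsets (t : nat) (S : {set 'I_n}) (P : pred {set 'I_n}) :=
  [set c : {set 'I_n} | [&& c \subset S, #|c| == t & P c]].

End Blocks.

Lemma card_tsets_sorted n t (S : {set 'I_n}) (P : pred {set 'I_n}) :
  #|tsets t S P| <= #|[set c : t.-tuple 'I_n |
    [&& sorted (fun x y : 'I_n => x < y) c, all (mem S) c & P [set x in c]]]|.
Proof.
have [->|[c0 c0P]] := set_0Vmem (tsets t S P); first by rewrite cards0.
have s0 : size (enum c0) == t by move: c0P; rewrite inE -cardE => /and3P[].
(* The default [Tuple s0] is never reached on the family, whose members have exactly [t]
   elements. *)
pose tp (c : {set 'I_n}) : t.-tuple 'I_n := insubd (Tuple s0) (enum c).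
have tpE c : c \in tsets t S P -> tp c = enum c :> seq _.
  by rewrite inE => /and3P[_ ct _]; rewrite val_insubd -cardE ct.
rewrite -(card_in_imset (f := tp)) => [|c d cP dP e]; last first.
  by apply/setP => x; rewrite -mem_enum -(tpE c) // e tpE // mem_enum.
apply: subset_leq_card; apply/subsetP => _ /imsetP[c cP ->].
rewrite inE tpE // sorted_enum_ord /=.
move: (cP); rewrite inE => /and3P[/subsetP cS _ Pc]; apply/andP; split.
  by apply/allP => x; rewrite mem_enum => /cS.
congr P: Pc; apply/setP => x; rewrite inE.
by rewrite -[x \in tp c]/(x \in (tp c : seq _)) tpE // mem_enum.
Qed.

(* A box inside the set of increasing tuples automatically has its sides in order,
   [B_1 < ... < B_t], so the unordered box theorem suffices for the ordered pattern. *)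
Lemma few_well_spread_sets t k l (A : 'M[bool]_(k, l)) K :
  0 < t -> col_partite t A -> exists L, forall m n (M : 'M[bool]_(m, n))
    (R : {set 'I_m}) (blk : 'I_m -> 'I_K) (S : {set 'I_n}),
  {in R &, forall r1 r2 : 'I_m, r1 <= r2 -> blk r1 <= blk r2} -> ~~ contains M A ->
  4 * #|tsets t S (fun c => k <= #|blocks_of M R blk c|)| <= 'C(#|S|, t) + 4 * L ^ t.
Proof.
move=> t0 hA.
(* [2 ^ t] times the factorial passes from powers to binomials, 4 is the assumed proportion, and
   [2 ^ K] is the loss in fixing the set [J] of blocks met. *)
have [L HL] := erdos_box t (2 ^ t * t`! * (4 * 2 ^ K)) (ltn0Sn l).
exists (maxn L (2 * t)) => m n M R blk S bmono nA.
set P := fun c => _.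
(* For small [S], all [t]-sets together fit in the additive term. *)
have [small|] := ltnP #|S| (maxn L (2 * t)).
  apply: leq_trans (leq_addl _ _); rewrite leq_mul2l /=.
  apply: (@leq_trans 'C(#|S|, t)).
    rewrite -cards_draws; apply: subset_leq_card; apply/subsetP => c.
    by rewrite !inE => /and3P[-> ->].
  by apply: leq_trans (bin_le_expn _ _) _; rewrite leq_exp2r // ltnW.
rewrite geq_max => /andP[LS tS].
apply: leq_trans (leq_addr _ _); rewrite leqNgt; apply: contra nA => many.
pose PJ J c := P c && (blocks_of M R blk c == J).
have sumP : #|tsets t S P| = \sum_(J in [set: {set 'I_K}]) #|tsets t S (PJ J)|.
  rewrite -sum1_card (partition_big (blocks_of M R blk) (mem [set: {set 'I_K}])).
    apply: eq_bigr => J _; rewrite -sum1_card; apply: eq_bigl => c.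
    by rewrite !inE /PJ -!andbA.
  by move=> c _; rewrite inE.
have P0 : 0 < #|tsets t S P|.
  by rewrite lt0n; apply: contraTneq many => ->; rewrite muln0.
have [J _] := sum_pigeonhole P0 (eq_leq sumP).
rewrite -powersetT card_powerset cardsT card_ord => HJ.
have J0 : 0 < #|tsets t S (PJ J)|.
  by move: HJ; case: #|tsets t S (PJ J)| => //; rewrite muln0 leqNgt P0.
have kJ : k <= #|J|.
  by case/card_gt0P: J0 => c; rewrite inE => /and3P[_ _ /andP[Pc /eqP <-]].
set G := [set c : t.-tuple 'I_n |
    [&& sorted (fun x y : 'I_n => x < y) c, all (mem S) c & PJ J [set x in c]]].
have GS c : c \in G -> all (mem S) c by rewrite inE => /and3P[].
have dG : #|S| ^ t <= 2 ^ t * t`! * (4 * 2 ^ K) * #|G|.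
  apply: leq_trans (expn_le_bin tS) _; rewrite -[X in _ <= X]mulnA leq_mul2l.
  apply/orP; right; apply: leq_trans (ltnW many) _.
  rewrite -mulnA leq_mul2l /=; apply: leq_trans HJ _.
  by rewrite leq_mul2l card_tsets_sorted orbT.
have [B Bl BG] := HL _ S G LS GS dG.
have jord (i : 'I_k) : i < #|J| := leq_trans (ltn_ord i) kJ.
pose jn (i : 'I_k) := enum_val (Ordinal (jord i)).
apply: (contains_of_boxes (I := fun i => [set r in R | blk r == jn i]) t0 hA Bl).
  move=> i1 i2 lt12 r1 r2; rewrite !inE => /andP[r1R /eqP b1] /andP[r2R /eqP b2].
  rewrite ltnNge; apply/negP => /(bmono _ _ r2R r1R); rewrite b1 b2 leqNgt => /negP[].
  rewrite /jn (enum_val_nth (jn i1)) [X in _ < nat_of_ord X](enum_val_nth (jn i1)).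
  exact: nth_enum_ltn.
move=> c /BG; rewrite inE => /and3P[srt _ /andP[_ /eqP bJ]]; split => // i.
have : jn i \in blocks_of M R blk [set x in c] by rewrite bJ enum_valP.
case/imsetP => r; rewrite inE => /andP[rR /forall_inP rM] e.
by exists r => [|x xc]; rewrite ?inE ?rR ?e ?eqxx // rM // inE.
Qed.

Local Open Scope ring_scope.

(** * The energy increment *)

(** Sum [(x i - x j) * (x i ^+ a - x j ^+ a) >= 0] over all pairs. *)
Lemma chebyshev_sum (F : realFieldType) (I : finType) (A : {set I}) (x : I -> F) a :
  (forall i, i \in A -> 0 <= x i) ->
  (\sum_(i in A) x i) * (\sum_(i in A) x i ^+ a) <= #|A|%:R * \sum_(i in A) x i ^+ a.+1.
Proof.
move=> x0.
have le2 i j : i \in A -> j \in A ->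
    x i * x j ^+ a + x j * x i ^+ a <= x i ^+ a.+1 + x j ^+ a.+1.
  move=> iA jA; rewrite -subr_ge0 !exprS.
  have -> : x i * x i ^+ a + x j * x j ^+ a - (x i * x j ^+ a + x j * x i ^+ a) =
    (x i - x j) * (x i ^+ a - x j ^+ a) by ring.
  have [ij|/ltW ji] := lerP (x i) (x j).
    by rewrite mulr_le0 // subr_le0 // lerXn2r // nnegrE x0.
  by rewrite mulr_ge0 // subr_ge0 // lerXn2r // nnegrE x0.
have : \sum_(i in A) \sum_(j in A) (x i * x j ^+ a + x j * x i ^+ a) <=
       \sum_(i in A) \sum_(j in A) (x i ^+ a.+1 + x j ^+ a.+1).
  by apply: ler_sum => i iA; apply: ler_sum => j jA; apply: le2.
set X := \sum_(i in A) x i; set Y := \sum_(i in A) x i ^+ a.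
set Z := \sum_(i in A) x i ^+ a.+1.
under eq_bigr do rewrite big_split /= -mulr_sumr -mulr_suml -/X -/Y.
rewrite big_split /= -mulr_suml -mulr_sumr -/X -/Y.
under eq_bigr do rewrite big_split /= sumr_const -/Z.
rewrite big_split /= sumr_const sumrMnl -/Z mulr_natl => H; lra.
Qed.

Lemma power_mean (F : realFieldType) (I : finType) (A : {set I}) (x : I -> F) a :
  (forall i, i \in A -> 0 <= x i) ->
  (\sum_(i in A) x i) ^+ a.+1 <= #|A|%:R ^+ a * \sum_(i in A) x i ^+ a.+1.
Proof.
move=> x0; elim: a => [|a IH].
  by rewrite expr0 mul1r expr1; under [X in _ <= X]eq_bigr do rewrite expr1.
rewrite exprS; apply: (@le_trans _ _ ((\sum_(i in A) x i) *
    (#|A|%:R ^+ a * \sum_(i in A) x i ^+ a.+1))).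
  by rewrite ler_wpM2l // sumr_ge0.
rewrite mulrCA [_ ^+ a.+1]exprSr -mulrA ler_wpM2l ?exprn_ge0 ?ler0n //.
exact: chebyshev_sum.
Qed.

Section Energy.
Variables (F : realFieldType) (m n : nat) (M : 'M[bool]_(m, n)) (mu : 'I_m -> F).
Hypothesis mu0 : forall r, 0 <= mu r.

Definition mass (R : {set 'I_m}) (c : {set 'I_n}) : F :=
  \sum_(r in common_rows M R c) mu r.

Definition energy t (R : {set 'I_m}) : F :=
  \sum_(c : {set 'I_n} | #|c| == t) mass R c ^+ t.

Lemma mass_ge0 R c : 0 <= mass R c.
Proof. exact: sumr_ge0. Qed.

Lemma energy_ge0 t R : 0 <= energy t R.
Proof. by apply: sumr_ge0 => c _; rewrite exprn_ge0 // mass_ge0. Qed.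

Definition common_cols t (rho : {ffun 'I_t -> 'I_m}) : {set 'I_n} :=
  [set x | [forall i, M (rho i) x]].

(* Dependent random choice: the energy averages over [t] random rows, drawn with weights. *)
Lemma energy_rows t R (P : pred {set 'I_n}) :
  \sum_(c : {set 'I_n} | (#|c| == t) && P c) mass R c ^+ t =
  \sum_(rho : {ffun 'I_t -> 'I_m})
    (\prod_i (if rho i \in R then mu (rho i) else 0)) *
    #|tsets t (common_cols rho) P|%:R.
Proof.
pose g r := if r \in R then mu r else 0.
have massE c : mass R c = \sum_r g r * [forall x in c, M r x]%:R.
  rewrite /mass big_mkcond; apply: eq_bigr => r _; rewrite inE /g.
  case: (r \in R) => /=; last by rewrite mul0r.
  by case: ifP; rewrite ?mulr1 ?mulr0.
(* The power expands over all choices [rho] of [t] rows; the indicators multiply to 1 exactly when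
   [c] lies in every chosen row. *)
have powE c : mass R c ^+ t = \sum_(rho : {ffun 'I_t -> 'I_m})
    (\prod_i g (rho i)) * (c \subset common_cols rho)%:R.
  rewrite massE -{1}(card_ord t) -prodr_const bigA_distr_bigA /=.
  apply: eq_bigr => rho _; rewrite big_split /=; congr (_ * _).
  have [sub|] := boolP (c \subset common_cols rho).
    apply: big1 => i _; suff -> : [forall x in c, M (rho i) x] by [].
    by apply/forall_inP => x /(subsetP sub); rewrite inE => /forallP.
  case/subsetPn => x xc; rewrite inE => /forallPn[i Mx].
  rewrite (bigD1 i) //= (_ : [forall x in c, _] = false) ?mul0r //.
  by apply/negP => /forall_inP /(_ _ xc); apply/negP.
under eq_bigr do rewrite powE.
rewrite exchange_big /=; apply: eq_bigr => rho _; rewrite -mulr_sumr; congr (_ * _).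
rewrite -sum1_card natr_sum big_mkcond [RHS]big_mkcond /=.
apply: eq_bigr => c _; rewrite !inE.
by case: (c \subset _); case: (#|c| == t); case: (P c).
Qed.

(** By [energy_rows] and [few], the well-spread sets carry at most a quarter of the energy plus an
    error. The mass of any other set splits over fewer than [k] blocks, where the power mean
    inequality applies. *)
Lemma energy_step t k K L (R : {set 'I_m}) (blk : 'I_m -> 'I_K) :
  (0 < t)%N ->
  (forall S : {set 'I_n},
    4 * #|tsets t S (fun c => k <= #|blocks_of M R blk c|)| <= 'C(#|S|, t) + 4 * L ^ t)%N ->
  energy t R <=
    2 * k%:R ^+ t * (\sum_(j : 'I_K) energy t [set r in R | blk r == j]) +
    2 * L%:R ^+ t * (\sum_(r in R) mu r) ^+ t.
Proof.
move=> t0 few; pose P c := (k <= #|blocks_of M R blk c|)%N.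
set E' := \sum_(j : 'I_K) _; set X := \sum_(r in R) mu r.
have good : 4 * \sum_(c : {set 'I_n} | (#|c| == t) && P c) mass R c ^+ t <=
    energy t R + 4 * L%:R ^+ t * X ^+ t.
  have -> : energy t R = \sum_(c : {set 'I_n} | (#|c| == t) && true) mass R c ^+ t.
    by apply: eq_bigl => c; rewrite andbT.
  rewrite !(energy_rows _ _ (fun c => _)).
  have -> : X ^+ t = \sum_(rho : {ffun 'I_t -> 'I_m})
      \prod_i (if rho i \in R then mu (rho i) else 0).
    by rewrite /X big_mkcond -{1}(card_ord t) -prodr_const bigA_distr_bigA.
  rewrite !mulr_sumr -big_split /=; apply: ler_sum => rho _.
  set p := \prod_i _.
  have p0 : 0 <= p by apply: prodr_ge0 => i _; case: ifP.
  have := few (common_cols rho); rewrite -cards_draws.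
  have -> : #|[set B : {set 'I_n} | B \subset common_cols rho & #|B| == t]| =
      #|tsets t (common_cols rho) (fun=> true)|.
    by apply: eq_card => c; rewrite !inE andbT.
  rewrite -/P -(ler_nat F) natrD !natrM natrX => le.
  by have := ler_wpM2l p0 le; lra.
have bad : \sum_(c : {set 'I_n} | (#|c| == t) && ~~ P c) mass R c ^+ t <= k%:R ^+ t * E'.
  rewrite /E' /energy exchange_big /= mulr_sumr.
  apply: (@le_trans _ _ (\sum_(c : {set 'I_n} | (#|c| == t) && ~~ P c)
      k%:R ^+ t * \sum_(j : 'I_K) mass [set r in R | blk r == j] c ^+ t)).
    apply: ler_sum => c /andP[_]; rewrite -ltnNge => small.
    have -> : mass R c = \sum_(j in blocks_of M R blk c) mass [set r in R | blk r == j] c.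
      rewrite /mass (partition_big blk (mem (blocks_of M R blk c))) /=; last first.
        by move=> r; apply: imset_f.
      apply: eq_bigr => j _; apply: eq_bigl => r; rewrite !inE.
      by rewrite -!andbA [(blk r == j) && _]andbC.
    have [t' ->] : exists t', t = t'.+1 by exists t.-1; rewrite prednK.
    apply: le_trans (power_mean _ _) _.
      by move=> j _; apply: mass_ge0.
    apply: ler_pM; first by rewrite exprn_ge0 ?ler0n.
    - by apply: sumr_ge0 => j _; rewrite exprn_ge0 ?mass_ge0.
    - apply: (@le_trans _ _ (k%:R ^+ t')).
        by rewrite lerXn2r ?nnegrE ?ler0n // ler_nat ltnW.
      rewrite exprS ler_peMl ?exprn_ge0 ?ler0n // ler1n.
      exact: leq_ltn_trans small.
    rewrite big_mkcond; apply: ler_sum => j _; case: ifP => // _.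
    by rewrite exprn_ge0 ?mass_ge0.
  rewrite [X in _ <= X](bigID P) /= addrC lerDl sumr_ge0 // => c _.
  by rewrite mulr_ge0 ?exprn_ge0 ?ler0n ?sumr_ge0 // => j _; rewrite exprn_ge0 ?mass_ge0.
have : energy t R = \sum_(c : {set 'I_n} | (#|c| == t) && P c) mass R c ^+ t +
    \sum_(c : {set 'I_n} | (#|c| == t) && ~~ P c) mass R c ^+ t.
  by rewrite /energy (bigID P).
(* Moving the quarter to the left leaves a factor 4/3, rounded up to 2 since both terms are
   nonnegative. *)
have e0 : 0 <= L%:R ^+ t * X ^+ t.
  by rewrite mulr_ge0 ?exprn_ge0 ?ler0n ?sumr_ge0.
have e1 : 0 <= k%:R ^+ t * E'.
  by rewrite mulr_ge0 ?exprn_ge0 ?ler0n ?sumr_ge0 // => j _; apply: energy_ge0.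
rewrite -!mulrA in good *; lra.
Qed.

End Energy.

(** * Iteration over scales of row intervals *)

Definition row_interval m a N : {set 'I_m} := [set r : 'I_m | (a <= r < a + N)%N].

Lemma card_row_interval m a N : (#|row_interval m a N| <= N)%N.
Proof.
rewrite cardE -(size_map val) -(size_iota a N).
apply: uniq_leq_size; first by rewrite map_inj_uniq ?enum_uniq //; apply: val_inj.
by move=> x /mapP[r]; rewrite mem_enum inE size_iota => h ->; rewrite mem_iota.
Qed.

Section EnergyBound.
Variables (F : realFieldType) (m n : nat) (M : 'M[bool]_(m, n)) (mu : 'I_m -> F).
Variables (t k K L Q s0 : nat) (eta : F).
Hypothesis mu0 : forall r, 0 <= mu r.
Hypothesis t0 : (0 < t)%N.

Definition degree (r : 'I_m) : nat := #|[set x | M r x]|.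

Lemma forall_in_row r (c : {set 'I_n}) :
  [forall x in c, M r x] = (c \subset [set x | M r x]).
Proof. by apply/forall_inP/subsetP => H x /H; rewrite inE. Qed.

Lemma mass_set1 r c : mass M mu [set r] c = mu r * (c \subset [set x | M r x])%:R.
Proof.
rewrite /mass big_mkcond (bigD1 r) //= big1 ?addr0 => [|i ir]; last first.
  by rewrite !inE (negPf ir).
rewrite !inE eqxx forall_in_row /=.
by case: (c \subset _); rewrite ?mulr1 ?mulr0.
Qed.

Lemma energy_set1 r : mu r * (degree r)%:R <= 1 -> energy M mu t [set r] <= 1.
Proof.
move=> mud; rewrite /energy.
apply: (@le_trans _ _ ((mu r * (degree r)%:R) ^+ t)); last first.
  by rewrite exprn_ile1 // mulr_ge0.
rewrite exprMn -natrX.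
apply: (@le_trans _ _ (mu r ^+ t * 'C(degree r, t)%:R)); last first.
  by rewrite ler_wpM2l ?exprn_ge0 // ler_nat bin_le_expn.
rewrite -cards_draws -sum1_card natr_sum mulr_sumr big_mkcond [X in _ <= X]big_mkcond.
apply: ler_sum => c _; rewrite mass_set1 inE andbC.
case: (#|c| == t) => //=; case: (c \subset _); first by rewrite !mulr1.
by rewrite mulr0 expr0n -leqn0 leqNgt t0.
Qed.

Lemma energy_set0 : energy M mu t set0 = 0.
Proof.
apply: big1 => c _; have -> : mass M mu set0 c = 0.
  by apply: big_pred0 => r; rewrite !inE.
by rewrite expr0n -leqn0 leqNgt t0.
Qed.

Lemma sum_mass :
  \sum_(c : {set 'I_n} | #|c| == t) mass M mu setT c = \sum_r mu r * 'C(degree r, t)%:R.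
Proof.
under eq_bigr do rewrite /mass big_mkcond.
rewrite exchange_big /=; apply: eq_bigr => r _.
rewrite -cards_draws -sum1_card natr_sum mulr_sumr big_mkcond [RHS]big_mkcond.
apply: eq_bigr => c _; rewrite !inE forall_in_row andbC.
by rewrite mulr1 andbT andbC; case: (#|c| == t).
Qed.

(** Power mean over the at most [n ^ t] column [t]-sets, with the total mass counted by rows. *)
Lemma energy_setT_ge :
  (\sum_r mu r * 'C(degree r, t)%:R) ^+ t <= n%:R ^+ (t * t.-1) * energy M mu t setT.
Proof.
rewrite -sum_mass; have [t' tE] : exists t', t = t'.+1 by exists t.-1; rewrite prednK.
have pm := @power_mean F _ [set c : {set 'I_n} | #|c| == t] (mass M mu setT) t'.
have {pm} := pm (fun c _ => mass_ge0 M mu0 _ _).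
under eq_bigl do rewrite inE.
under [X in _ * X]eq_bigl do rewrite inE.
rewrite -tE => /le_trans; apply.
rewrite ler_wpM2r ?energy_ge0 // card_draws card_ord tE /= -tE exprM.
by rewrite lerXn2r ?nnegrE ?exprn_ge0 ?ler0n // -natrX ler_nat bin_le_expn.
Qed.

Hypothesis mu_eta : forall r, mu r <= eta.
Hypothesis mu_degree : forall r, mu r * (degree r)%:R <= 1.
Hypothesis few : forall (R : {set 'I_m}) (blk : 'I_m -> 'I_K) (S : {set 'I_n}),
  {in R &, forall r1 r2 : 'I_m, (r1 <= r2 -> blk r1 <= blk r2)%N} ->
  (4 * #|tsets t S (fun c => k <= #|blocks_of M R blk c|)| <= 'C(#|S|, t) + 4 * L ^ t)%N.
Hypothesis K0 : (0 < K)%N.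
Hypothesis kQ : (4 * k ^ t * K <= Q)%N.
Hypothesis KQ : (K <= Q)%N.
Hypothesis eta0 : 0 <= eta.

(** Induction on the scale, each scale costing a factor [Q]. The additive errors of all scales are
    absorbed in one term sized for the top scale [s0]. *)
Lemma energy_interval s a : (s <= s0)%N ->
  energy M mu t (row_interval m a (K ^ s)) <=
  Q%:R ^+ s * (1 + 4 * (L%:R * eta) ^+ t * (K ^ s0)%:R ^+ t.-1).
Proof.
set E := 4 * _ * _.
have E0 : 0 <= E by rewrite !mulr_ge0 ?exprn_ge0 ?mulr_ge0 ?ler0n.
elim: s a => [|s IH] a ss.
  rewrite expr0 mul1r; apply: (@le_trans _ _ 1); last by rewrite lerDl.
  have [am|ma] := ltnP a m.
    rewrite (_ : row_interval _ _ _ = [set Ordinal am]) ?energy_set1 //.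
    by apply/setP => r; rewrite !inE -val_eqE /= expn0; lia.
  rewrite (_ : row_interval _ _ _ = set0) ?energy_set0 //.
  by apply/setP => r; rewrite !inE expn0; have := ltn_ord r; lia.
set R := row_interval _ _ _.
(* On [R] the quotient is below [K], so the default block is reached only outside [R]. *)
pose blk (r : 'I_m) : 'I_K := insubd (Ordinal K0) ((r - a) %/ K ^ s)%N.
have Ks0 : (0 < K ^ s)%N by rewrite expn_gt0 K0.
have blkE r : r \in R -> blk r = ((r - a) %/ K ^ s)%N :> nat.
  rewrite inE => /andP[ar ra]; rewrite val_insubd ltn_divLR //.
  by rewrite -expnS; case: ifP => //; lia.
have bmono : {in R &, forall r1 r2 : 'I_m, (r1 <= r2 -> blk r1 <= blk r2)%N}.
  by move=> r1 r2 R1 R2 le12; rewrite !blkE // leq_div2r // leq_sub2r.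
have child j : [set r in R | blk r == j] = row_interval m (a + j * K ^ s) (K ^ s).
  apply/setP => r; rewrite [in LHS]inE [in RHS]inE.
  have jK := ltn_ord j.
  have jKs : (j.+1 * K ^ s <= K ^ s.+1)%N by rewrite expnS leq_mul2r jK orbT.
  have [rR|rR] := boolP (r \in R); last first.
    by move: rR; rewrite inE /=; lia.
  rewrite -val_eqE /= blkE // eqn_leq -ltnS ltn_divLR // leq_divRL //.
  by move: rR; rewrite inE; lia.
apply: le_trans (energy_step mu0 t0 (fun S => few S bmono)) _.
have b1 : \sum_(j : 'I_K) energy M mu t [set r in R | blk r == j] <=
    K%:R * (Q%:R ^+ s * (1 + E)).
  apply: (@le_trans _ _ (\sum_(j : 'I_K) Q%:R ^+ s * (1 + E))).
    by apply: ler_sum => j _; rewrite child IH // ltnW.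
  by rewrite sumr_const card_ord mulr_natl.
have b2 : (\sum_(r in R) mu r) ^+ t <= (K ^ s.+1)%:R ^+ t * eta ^+ t.
  rewrite -exprMn lerXn2r ?nnegrE ?sumr_ge0 ?mulr_ge0 ?ler0n //.
  apply: (@le_trans _ _ (\sum_(r in R) eta)); first exact: ler_sum.
  by rewrite sumr_const -[eta *+ _]mulr_natl ler_wpM2r // ler_nat card_row_interval.
have b3 : 4 * k%:R ^+ t * K%:R <= Q%:R :> F.
  by rewrite -natrX -!natrM ler_nat.
have b4 : (K ^ s.+1)%:R ^+ t <= Q%:R ^+ s.+1 * (K ^ s0)%:R ^+ t.-1 :> F.
  have -> : t = t.-1.+1 by rewrite prednK.
  rewrite /= exprS ler_pM ?exprn_ge0 ?ler0n //.
    by rewrite natrX lerXn2r ?nnegrE ?ler0n // ler_nat.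
  by rewrite lerXn2r ?nnegrE ?ler0n // ler_nat leq_pexp2l.
have Qs0 : 0 <= Q%:R ^+ s * (1 + E) by rewrite mulr_ge0 ?exprn_ge0 ?ler0n ?addr_ge0.
(* The target is split in two halves: [4 * k ^ t * K <= Q] pays for the main term, the factor 4 in
   [E] for the error. *)
have c1 : 2 * k%:R ^+ t * (K%:R * (Q%:R ^+ s * (1 + E))) <=
    2^-1 * Q%:R * (Q%:R ^+ s * (1 + E)).
  by rewrite mulrA ler_wpM2r //; lra.
have c2 : 2 * L%:R ^+ t * ((K ^ s.+1)%:R ^+ t * eta ^+ t) <= 2^-1 * (Q%:R ^+ s.+1 * E).
  have Le : 0 <= (L%:R * eta) ^+ t by rewrite exprn_ge0 // mulr_ge0 ?ler0n.
  have := ler_wpM2l Le b4; rewrite /E exprMn; lra.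
have d1 : 2 * k%:R ^+ t * (\sum_(j : 'I_K) energy M mu t [set r in R | blk r == j]) <=
    2^-1 * Q%:R * (Q%:R ^+ s * (1 + E)).
  by apply: le_trans c1; rewrite ler_wpM2l // mulr_ge0 ?exprn_ge0 ?ler0n.
have d2 : 2 * L%:R ^+ t * (\sum_(r in R) mu r) ^+ t <= 2^-1 * (Q%:R ^+ s.+1 * E).
  by apply: le_trans c2; rewrite ler_wpM2l // mulr_ge0 ?exprn_ge0 ?ler0n.
have d3 : 0 <= Q%:R ^+ s.+1 :> F by rewrite exprn_ge0 ?ler0n.
apply: le_trans (lerD d1 d2) _; rewrite !exprS in d3 *; lra.
Qed.

End EnergyBound.

(** * Weight against energy *)

Lemma weightE m n (M : 'M[bool]_(m, n)) : weight M = (\sum_r degree M r)%N.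
Proof.
rewrite /weight -sum1_card (eq_bigl (fun ij : 'I_m * 'I_n => true && M ij.1 ij.2)).
  rewrite -(pair_big_dep predT (fun i j => M i j) (fun _ _ => 1%N)) /=.
  apply: eq_bigr => r _; rewrite /degree -sum1_card.
  by apply: eq_bigl => x; rewrite inE.
by move=> ij; rewrite inE.
Qed.

Definition heavy m n (M : 'M[bool]_(m, n)) : {set 'I_m} :=
  [set r | weight M <= 2 * m * degree M r]%N.

(** Each light row has less than half the average degree, so together they hold at most half the
    weight. *)
Lemma weight_le_heavy m n (M : 'M[bool]_(m, n)) :
  (weight M <= 2 * \sum_(r in heavy M) degree M r)%N.
Proof.
have [m0|m0] := posnP m.
  by rewrite weightE big1 // => r; have := ltn_ord r; rewrite [X in (_ < X)%N]m0.
have light : (2 * m * \sum_(r | r \notin heavy M) degree M r <= m * weight M)%N.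
  rewrite big_distrr /=; apply: (@leq_trans (\sum_(r : 'I_m) weight M)).
    rewrite big_mkcond; apply: leq_sum => r _; case: ifP => //.
    by rewrite inE -ltnNge => /ltnW.
  by rewrite sum_nat_const card_ord.
have wE : weight M = (\sum_(r in heavy M) degree M r +
    \sum_(r | r \notin heavy M) degree M r)%N.
  by rewrite weightE (bigID (mem (heavy M))).
move: light; rewrite (mulnC 2%N m) -mulnA leq_pmul2l //.
move: wE; set x := \sum_(r in _) _; set y := \sum_(r | _) _; lia.
Qed.

Section InverseDegree.
Variables (F : realFieldType) (n : nat) (M : 'M[bool]_n).
Let w := weight M.

Definition inv_degree (r : 'I_n) : F :=
  if r \in heavy M then (degree M r)%:R^-1 else 0.

Lemma inv_degree_ge0 r : 0 <= inv_degree r.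
Proof. by rewrite /inv_degree; case: ifP; rewrite ?invr_ge0 ?ler0n. Qed.

Lemma inv_degree_mul r : inv_degree r * (degree M r)%:R <= 1.
Proof.
rewrite /inv_degree; case: ifP => _; last by rewrite mul0r.
have [->|d0] := posnP (degree M r); first by rewrite mulr0.
by rewrite mulVf // pnatr_eq0 -lt0n.
Qed.

Lemma inv_degree_le r : (0 < w)%N -> inv_degree r <= 2 * n%:R / w%:R.
Proof.
move=> w0; rewrite /inv_degree; case: ifP => [|_]; last first.
  by rewrite divr_ge0 ?mulr_ge0 ?ler0n.
rewrite inE -/w => wd; have d0 : (0 < degree M r)%N by lia.
rewrite ler_pdivlMr ?ltr0n // mulrC ler_pdivrMr ?ltr0n //.
by rewrite -!natrM ler_nat.
Qed.

(** Power mean over the heavy rows bounds [w ^ u.+1] by a sum of [d ^ u.+1 = d ^ t / d], comparable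
    to the weighted count of [t]-sets inside rows, to which [energy_setT_ge] applies. *)
Lemma weight_le_energy u (t := u.+2) : (0 < w)%N -> (4 * t * n <= w)%N ->
  (w ^ (u.+1 * t))%:R <=
  (2 ^ (u.+1 * t) * n ^ (u * t) * (2 ^ t * t`!) ^ t * n ^ (t * u.+1))%:R *
  energy M inv_degree t setT.
Proof.
move=> w0 wbig.
have [C0 defC0] : exists C0, C0 = (2 ^ t * t`!)%N by eexists.
rewrite -defC0; set S := \sum_r inv_degree r * 'C(degree M r, t)%:R.
have S0 : 0 <= S by apply: sumr_ge0 => r _; rewrite mulr_ge0 ?ler0n ?inv_degree_ge0.
have n0 : (0 < n)%N.
  move: w0; rewrite /w weightE lt0n; case: (n) M => // M'.
  by rewrite big_ord0.
have main : (w ^ u.+1)%:R <= (2 ^ u.+1 * n ^ u * C0)%:R * S.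
  apply: (@le_trans _ _ (2 ^+ u.+1 * (\sum_(r in heavy M) (degree M r)%:R) ^+ u.+1)).
    rewrite -exprMn natrX lerXn2r ?nnegrE ?ler0n ?mulr_ge0 ?sumr_ge0 //.
    by rewrite -natr_sum -natrM ler_nat weight_le_heavy.
  rewrite !natrM -!mulrA natrX ler_pM2l ?exprn_gt0 ?ltr0n //.
  apply: le_trans (power_mean _ _) _; first by move=> r _; apply: ler0n.
  apply: ler_pM; rewrite ?exprn_ge0 ?ler0n ?sumr_ge0 //.
  - by move=> r _; rewrite exprn_ge0 ?ler0n.
  - rewrite natrX lerXn2r ?nnegrE ?ler0n // ler_nat.
    by rewrite -[X in (_ <= X)%N]card_ord max_card.
  rewrite mulr_sumr big_mkcond; apply: ler_sum => r _; case: ifP => rH; last first.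
    by rewrite !mulr_ge0 ?ler0n ?inv_degree_ge0.
  rewrite /inv_degree rH.
  (* The assumption [4 * t * n <= w] makes heavy rows long enough for [expn_le_bin]. *)
  have dt : (2 * t <= degree M r)%N.
    move: rH; rewrite inE -/w => wd.
    by rewrite -(@leq_pmul2l (2 * n)) ?muln_gt0 ?n0 //; lia.
  have d0 : (0 < degree M r)%N by apply: leq_trans dt.
  rewrite mulrCA ler_pdivlMl ?ltr0n // -exprS.
  by rewrite -natrX -natrM ler_nat defC0 expn_le_bin.
have := @energy_setT_ge F n n M inv_degree t inv_degree_ge0 isT; rewrite -/S /= => up.
rewrite expnM natrX.
apply: (@le_trans _ _ (((2 ^ u.+1 * n ^ u * C0)%:R * S) ^+ t)).
  by rewrite lerXn2r ?nnegrE ?ler0n ?mulr_ge0 ?ler0n.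
rewrite exprMn -natrX !expnMn -!expnM [in X in _ <= X]natrM -mulrA ler_wpM2l ?ler0n //.
by rewrite natrX.
Qed.

End InverseDegree.

(** An integer form of [w >= n ^ (2 - 1/t)]; this weaker bound keeps the error term of the energy
    bounded. *)
Lemma weight_pow_ge t n w : (0 < t)%N -> (n ^ (4 * t * t + 1 - 2 * t) <= w ^ (2 * t * t))%N ->
  (n ^ (2 * t).-1 <= w ^ t)%N.
Proof.
move=> t0 H; have [->|n0] := posnP n; first by rewrite exp0n //; lia.
rewrite -(@leq_exp2r _ _ (2 * t)) ?muln_gt0 // -!expnM.
rewrite [(t * _)%N]mulnC; apply: leq_trans H; rewrite leq_pexp2l //; nia.
Qed.

(* The exponents are those of [n] in the theorem, multiplied by [2 t^2].  The base
   [b] is the loss in the energy increment; taking [K = b^(4t)] turns the total loss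
   [b^s0] over [s0 ~ log_K n] scales into [(K n)^(1/(4t))], hence the comparison of
   [4t]-th powers. *)
Lemma weight_lt t k l (A : 'M[bool]_(k, l)) :
  (2 <= t)%N -> col_partite t A -> exists n0, forall n (M : 'M[bool]_n),
  (n0 <= n)%N -> ~~ contains M A ->
  (weight M ^ (2 * t * t) < n ^ (4 * t * t + 1 - 2 * t))%N.
Proof.
case: t => [//|[//|u]] _; set t := u.+2 => hA.
have t0 : (0 < t)%N by [].
have exp1 : (u.+1 + t = (2 * t).-1)%N by rewrite /t; lia.
(* The surplus [(2 * u).+1] is positive; it forces [n <= C] at the end, a contradiction. *)
have exp2 : ((4 * t * t + 1 - 2 * t) * (2 * u.+1) =
    (2 * u).+1 + (4 * t * (u * t + t * u.+1) + (4 * t).+1))%N.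
  have -> : (4 * t * t + 1 - 2 * t = 4 * u * u + 14 * u + 13)%N by rewrite /t; nia.
  by rewrite /t; lia.
(* [k.+1] keeps [b > 1] even when [k = 0]. *)
have [b bE] : exists b, b = (4 * k.+1 ^ t)%N by eexists.
have [K KE] : exists K, K = (b ^ (4 * t))%N by eexists.
have [Q QE] : exists Q, Q = (b * K)%N by eexists.
have b1 : (1 < b)%N by rewrite bE (leq_trans _ (leq_pmulr 4 _)) ?expn_gt0.
have b0 : (0 < b)%N by apply: ltnW.
have K1 : (1 < K)%N by have := @ltn_exp2r 1 b (4 * t) isT; rewrite KE exp1n b1.
have K0 : (0 < K)%N by apply: ltnW.
have [L HL] := few_well_spread_sets K t0 hA.
pose C1 := (1 + 4 * L ^ t * 2 ^ t * K ^ u.+1)%N.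
pose C2 := (2 ^ (u.+1 * t) * (2 ^ t * t`!) ^ t * C1)%N.
pose C := (C2 ^ (4 * t) * K ^ (4 * t).+1)%N.
(* In turn: for the final contradiction, for [up_log_bounds], and for [wbig]. *)
exists (maxn C.+1 (maxn 2 ((4 * t) ^ t))) => n M.
rewrite !geq_max => /and3P[nC n2 nt] nA; rewrite ltnNge; apply/negP => nw.
have n0 : (0 < n)%N by apply: ltnW.
set w := weight M in nw.
have nwt : (n ^ (2 * t).-1 <= w ^ t)%N by apply: weight_pow_ge.
have w0 : (0 < w)%N.
  rewrite lt0n; apply: contraTneq nwt => ->.
  by rewrite exp0n // -ltnNge expn_gt0 n0.
have wbig : (4 * t * n <= w)%N.
  rewrite leqNgt; apply: contraTN nwt => small; rewrite -ltnNge.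
  apply: (@leq_trans ((4 * t * n) ^ t)%N); first by rewrite ltn_exp2r.
  rewrite expnMn -exp1 expnD leq_mul2r; apply/orP; right; apply: leq_trans nt _.
  by rewrite -[X in (X <= _)%N]expn1 leq_pexp2l.
have {HL} few R blk S bm := HL n n M R blk S bm nA.
(* The least scale whose interval covers all [n] rows; it overshoots by a factor at most [K]. *)
pose s0 := up_log K n.
have /andP[sl su] := up_log_bounds K1 n2.
have Kn : (K ^ s0 <= K * n)%N.
  have -> : s0 = (up_log K n).-1.+1 by rewrite prednK // up_log_gt0 K1.
  by rewrite expnS leq_mul2l ltnW ?orbT.
have [eta etaE] : exists eta : rat, eta = 2 * n%:R / w%:R by eexists.
have eta0 : 0 <= eta by rewrite etaE divr_ge0 ?mulr_ge0 ?ler0n.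
have kQ : (4 * k ^ t * K <= Q)%N.
  by rewrite QE bE leq_mul2r leq_mul2l leq_exp2r // leqnSn !orbT.
have KQ : (K <= Q)%N by rewrite QE leq_pmull.
have mu_eta r : inv_degree rat M r <= eta by rewrite etaE inv_degree_le.
have := energy_interval (@inv_degree_ge0 rat n M) t0
  mu_eta (@inv_degree_mul rat n M) few K0 kQ KQ eta0
  0 (leqnn s0).
have -> : row_interval n 0 (K ^ s0) = setT.
  by apply/setP => r; rewrite !inE add0n (leq_trans (ltn_ord r)).
set E := 1 + _ => up.
(* With [eta = 2n/w] and [K ^ s0 <= K * n], the error is at most a constant times
   [n ^ (2t-1) / w ^ t], which [nwt] bounds. *)
have EC : E <= C1%:R.
  pose c := (4 * L ^ t * 2 ^ t)%N.
  have cE : c%:R = 4 * L%:R ^+ t * 2 ^+ t :> rat by rewrite /c 2!natrM !natrX.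
  have EE : E = 1 + c%:R * ((n ^ t * (K ^ s0) ^ u.+1)%:R / (w ^ t)%:R).
    rewrite /E cE etaE [(n ^ t * _)%:R]natrM ![(_ ^ t)%:R]natrX.
    by rewrite [((K ^ s0) ^ _)%:R]natrX !exprMn exprVn; ring.
  rewrite EE /C1 -/c natrD lerD2l [(c * _)%:R]natrM ler_wpM2l ?ler0n //.
  rewrite ler_pdivrMr ?ltr0n ?expn_gt0 ?w0 // -natrM ler_nat mulnC.
  apply: (@leq_trans ((K * n) ^ u.+1 * n ^ t)%N).
    by rewrite leq_mul2r leq_exp2r // Kn orbT.
  by rewrite expnMn -mulnA -expnD exp1; apply: leq_mul (leqnn _) nwt.
have low := @weight_le_energy rat n M u w0 wbig.
have {low up} : ((w ^ (u.+1 * t))%:R : rat) <=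
    (2 ^ (u.+1 * t) * n ^ (u * t) * (2 ^ t * t`!) ^ t * n ^ (t * u.+1) *
      (Q ^ s0 * C1))%:R.
  apply: le_trans low _; rewrite [X in _ <= X]natrM ler_wpM2l ?ler0n //.
  by apply: le_trans up _; rewrite natrM natrX ler_wpM2l ?exprn_ge0 ?ler0n.
rewrite ler_nat -(@leq_exp2r _ _ (4 * t)) // => bound.
(* Since [b ^ (4 * t) = K], the left side equals [(K ^ s0) ^ (4 * t).+1]. *)
have Qs : ((Q ^ s0) ^ (4 * t) <= (K * n) ^ (4 * t).+1)%N.
  rewrite QE expnMn expnMn -expnM (mulnC s0) expnM -KE -expnS.
  by rewrite leq_exp2r.
have {bound} bound : ((w ^ (2 * t * t)) ^ (2 * u.+1) <=
    C * n ^ ((4 * t) * (u * t + t * u.+1) + (4 * t).+1))%N.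
  rewrite -expnM (_ : 2 * t * t * (2 * u.+1) = u.+1 * t * (4 * t))%N; last by ring.
  rewrite expnM; apply: leq_trans bound _.
  have -> : (2 ^ (u.+1 * t) * n ^ (u * t) * (2 ^ t * t`!) ^ t * n ^ (t * u.+1) *
    (Q ^ s0 * C1) = C2 * n ^ (u * t + t * u.+1) * Q ^ s0)%N.
    by rewrite /C2 expnD; ring.
  rewrite expnMn [((C2 * _) ^ _)%N]expnMn -expnM (mulnC _ (4 * t)%N) expnD /C.
  by apply: leq_trans (leq_mul (leqnn _) Qs) _; rewrite expnMn mulnACA.
have {bound} := leq_trans _ bound.
move=> /(_ ((n ^ (4 * t * t + 1 - 2 * t)) ^ (2 * u.+1))%N).
rewrite leq_exp2r // => /(_ nw); rewrite -expnM.
rewrite exp2 expnD leq_pmul2r ?expn_gt0 ?n0 // => nC'.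
have : (n <= n ^ (2 * u).+1)%N by rewrite -[X in (X <= _)%N]expn1 leq_pexp2l.
by move=> le; have := leq_trans le nC'; rewrite leqNgt nC.
Qed.

(* Passage to real exponents *)
Local Close Scope ring_scope.
From Stdlib Require Import Reals Lra.

Lemma INR_expn a b : INR (expn a b) = (INR a ^ b)%R.
Proof. by elim: b => // b IH; rewrite expnS /= -IH -mult_INR. Qed.


Theorem theorem1p1 (t k l : nat) (A : 'M[bool]_(k, l)) :
  (2 <= t)%N -> col_partite t A ->
  forall eps : R, (0 < eps)%R ->
  exists n0 : nat, forall n : nat, (n0 <= n)%N ->
    (INR (ex n A) < Rpower (INR n)
       (2 - 1 / INR t + 1 / (2 * INR t ^ 2) + eps))%R.
Proof.
move=> t2 hA eps eps0; have [n0 Hn0] := weight_lt t2 hA.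
exists (maxn n0 1) => n; rewrite geq_max => /andP[n0n n1].
set p := (4 * t * t + 1 - 2 * t)%N in Hn0; set q := (2 * t * t)%N in Hn0.
have exlt : expn (ex n A) q < expn n p.
  rewrite /ex; elim/big_ind: _ => [|x y ltx lty|M nA]; last exact: Hn0.
    by rewrite exp0n ?expn_gt0 ?n1 // /q !muln_gt0; case: (t) t2.
  by rewrite /maxn; case: ifP.
have n_gt0 : (0 < INR n)%R by apply: lt_0_INR; apply/ssrnat.ltP.
have n_ge1 : (1 <= INR n)%R by apply: (le_INR 1); apply/ssrnat.leP.
set a := (2 - 1 / INR t + 1 / (2 * INR t ^ 2))%R.
apply: (Rlt_le_trans _ (Rpower (INR n) a)); last by apply: Rle_Rpower => //; Lra.lra.
have t_gt0 : (0 < INR t)%R by apply: lt_0_INR; apply/ssrnat.ltP; apply: ltnW.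
(* The real exponent [a] is [p / q], so comparing [q]-th powers reduces the claim to [exlt]. *)
have aq : (a * INR q = INR p)%R.
  rewrite /p -minusE -plusE.
  rewrite minus_INR; last by apply/ssrnat.leP; nia.
  rewrite /q plus_INR !mult_INR /a; simpl (INR 4); simpl (INR 2); simpl (INR 1).
  by field; Lra.lra.
apply: Rnot_le_lt => le; apply: (Rlt_not_le (INR n ^ p) (INR (ex n A) ^ q)).
  by rewrite -!INR_expn; apply: lt_INR; apply/ssrnat.ltP.
have -> : (INR n ^ p = Rpower (INR n) a ^ q)%R.
  by rewrite -!Rpower_pow ?Rpower_mult ?aq //; apply: exp_pos.
by apply: pow_incr; split=> //; apply/Rlt_le/exp_pos.
Qed.
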